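(* Let $X$ be a topological space, $Z$ a Hausdorff space, $(Z_1,\lambda)$ an equiconnected subspace of $Z$, and $g:X\to Z$ a mapping. Let $(G_n)_{n=0}^{\infty}$ be a sequence of functionally open subsets of $X^2$, $(F_n)_{n=0}^{\infty}$ a sequence of functionally closed subsets of $X^2$, $(\varphi_n)_{n=1}^{\infty}$ a sequence of separately continuous functions $\varphi_n:X^2\to[0,1]$, and $(g_n)_{n=1}^{\infty}$ a sequence of continuous mappings $g_n:X\to Z_1$, such that the following conditions hold: (1) $G_0=F_0=X^2$ and $\Delta=\{(x,x):x\in X\}\subseteq G_{n+1}\subseteq F_n\subseteq G_n$ for every $n\in\mathbb N$; (2) $X^2\setminus G_n\subseteq \varphi_n^{-1}(0)$ and $F_n\subseteq\varphi_n^{-1}(1)$ for every $n\in\mathbb N$; (3) $\lim_{n\to\infty}\lambda(g_n(x_n),g_{n+1}(x_n),t_n)=g(x)$ (limit in $Z$) for every $x\in X$, every sequence $(t_n)_{n=1}^{\infty}$ of points $t_n\in[0,1]$ and every sequence $(x_n)_{n=1}^{\infty}$ of points $x_n\in X$ such that $(x_n,x)\in F_{n-1}$ for all $n\in\mathbb N$. Then the mapping $f:X^2\to Z$ defined by $$f(x,y)=\begin{cases}\lambda(g_n(x),g_{n+1}(x),\varphi_n(x,y)), & (x,y)\in F_{n-1}\setminus F_n,\ n\in\mathbb N,\\ g(x), & (x,y)\in E=\bigcap_{n=1}^{\infty}G_n,\end{cases}$$ is separately continuous.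
   Context: $\mathbb N=\{1,2,3,\dots\}$. A mapping defined on $X^2=X\times X$ is separately continuous if it is continuous with respect to each of its two variables when the other one is fixed. A subset of a topological space $T$ is functionally closed if it is of the form $h^{-1}(0)$ for some continuous $h:T\to[0,1]$; it is functionally open if its complement is functionally closed. A topological space $Z_1$ is equiconnected, written $(Z_1,\lambda)$, if $\lambda:Z_1\times Z_1\times[0,1]\to Z_1$ is a continuous mapping such that $\lambda(x,y,0)=\lambda(y,x,1)=x$ for all $x,y\in Z_1$ and $\lambda(x,x,t)=x$ for all $x\in Z_1$ and $t\in[0,1]$. An equiconnected subspace $(Z_1,\lambda)$ of $Z$ is a subset $Z_1\subseteq Z$ which, with the subspace topology, is equiconnected via $\lambda$. *)

(* Defs.v *)
From HB Require Import structures.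
From mathcomp Require Import all_boot all_order all_algebra.
From mathcomp Require Import all_classical all_reals all_analysis.

Set Implicit Arguments.
Unset Strict Implicit.
Unset Printing Implicit Defensive.

Import Order.TTheory GRing.Theory Num.Theory.
Import numFieldNormedType.Exports.

Local Open Scope classical_set_scope.
Local Open Scope ring_scope.

Definition separately_continuous (S T U : topologicalType) (f : S * T -> U) :=
  (forall x : S, continuous (fun y : T => f (x, y))) /\
  (forall y : T, continuous (fun x : S => f (x, y))).

Definition functionally_closed (R : realType) (T : topologicalType)
    (A : set T) :=
  exists h : T -> R, [/\ continuous h,
    (forall x, h x \in `[0, 1]) & A = h @^-1` [set 0]].

Definition functionally_open (R : realType) (T : topologicalType)
    (A : set T) :=
  functionally_closed R (~` A).

(* [lambda] is a total function on [Z * Z * R], only its restriction to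
   [Z1 * Z1 * [0, 1]] matters; [{within A, continuous f}] is continuity of the
   restriction of [f] to [A] for the subspace topology on [A]. *)
Definition equiconnected_subspace (R : realType) (Z : topologicalType)
    (Z1 : set Z) (lambda : Z * Z * R -> Z) :=
  [/\ (forall x y t, Z1 x -> Z1 y -> t \in `[0, 1] -> Z1 (lambda (x, y, t))),
      {within Z1 `*` Z1 `*` `[0, 1]%classic, continuous lambda},
      (forall x y, Z1 x -> Z1 y ->
         lambda (x, y, 0) = x /\ lambda (y, x, 1) = x) &
      (forall x t, Z1 x -> t \in `[0, 1] -> lambda (x, x, t) = x)].

(* The case distinction defining [f] in terms of [G], [F], [phi], [u], [g];
   the terms of index 0 of [phi] and [u] are never used. *)
Definition piecewise_spec (R : realType) (X Z : topologicalType)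
    (lambda : Z * Z * R -> Z) (g : X -> Z) (G F : nat -> set (X * X))
    (phi : nat -> X * X -> R) (u : nat -> X -> Z) (f : X * X -> Z) :=
  (forall n, (0 < n)%N -> forall x y, (F n.-1 `\` F n) (x, y) ->
     f (x, y) = lambda (u n x, u n.+1 x, phi n (x, y))) /\
  (forall x y, (\bigcap_(n in [set n | (0 < n)%N]) G n) (x, y) ->
     f (x, y) = g x).

(* Main.v *)
(** [f] is continuous in each variable at the points outside [E] because two
    consecutive pieces agree on [F_n \ G_{n+1}], where [phi_n = 1] and
    [phi_{n+1} = 0].  At points of [E] continuity follows from condition (3),
    which is uniform: otherwise, choosing bad points [x_n] and [t_n] would
    give a sequence violating (3).  Applying (3) to constant sequences shows
    that [g x = g y] for [(x, y)] in [E], so that the limit is the right one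
    in either variable. *)
Require Import Defs.
From HB Require Import structures.
From mathcomp Require Import all_boot all_order all_algebra.
From mathcomp Require Import all_classical all_reals all_analysis.

Set Implicit Arguments.
Unset Strict Implicit.
Unset Printing Implicit Defensive.

Import Order.TTheory GRing.Theory Num.Theory.
Import numFieldNormedType.Exports.

Local Open Scope classical_set_scope.
Local Open Scope ring_scope.

Lemma continuous_pair (S T U : topologicalType) (f : S -> T) (g : S -> U) :
  continuous f -> continuous g -> continuous (fun s => (f s, g s)).
Proof. by move=> fc gc s; exact: cvg_pair (fc s) (gc s). Qed.

(** Needed because [lambda] is a total map known to be continuous only within [Z1], [Z1] and
    [[0, 1]]; here [h] takes all its values in that set. *)
Lemma continuous_comp_within (S T U : topologicalType) (A : set T)
    (f : T -> U) (h : S -> T) :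
  {within A, continuous f} -> continuous h -> (forall s, A (h s)) ->
  continuous (f \o h).
Proof.
move=> /subspace_continuousP fA hc hA s.
apply: (@cvg_comp _ _ _ h f _ (within A (nbhs (h s)))); last exact: fA.
move=> W /= W_near; have := hc s _ W_near.
by apply: (@filterS _ (nbhs s)) => s' /(_ (hA s')).
Qed.

Lemma functionally_closed_closed (R : realType) (T : topologicalType)
    (A : set T) : functionally_closed R A -> closed A.
Proof.
move=> [h [hc _ ->]]; apply: preimage_closed => [x _|]; first exact: hc.
exact: closed_eq.
Qed.

Lemma functionally_open_open (R : realType) (T : topologicalType)
    (A : set T) : functionally_open R A -> open A.
Proof. by move=> /functionally_closed_closed; rewrite closedC. Qed.

Lemma decreasing_subset (T : Type) (F : nat -> set T) :
  (forall n, F n.+1 `<=` F n) -> forall m n, (m <= n)%N -> F n `<=` F m.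
Proof.
move=> FS m n; elim: n => [|n IHn]; first by rewrite leqn0 => /eqP ->.
by rewrite leq_eqVlt => /orP[/eqP -> //|/IHn Fmn] x /FS /Fmn.
Qed.

Lemma exists_layer (T : Type) (F : nat -> set T) (p : T) (m : nat) :
  F 0%N = setT -> ~ F m p -> exists n, (F n `\` F n.+1) p.
Proof.
move=> F0; elim: m => [|m IHm] nFp; first by case: nFp; rewrite F0.
by have [Fm|/IHm //] := pselect (F m p); exists m.
Qed.

Lemma layer_unique (T : Type) (F : nat -> set T) (p : T) (m n : nat) :
  (forall n, F n.+1 `<=` F n) ->
  (F m `\` F m.+1) p -> (F n `\` F n.+1) p -> m = n.
Proof.
move=> FS [Fm nFm] [Fn nFn]; have Fle := decreasing_subset FS.
by case: (ltngtP m n) => // mn; [case: nFm | case: nFn]; exact: Fle mn _ _.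
Qed.

(** The one-variable form of the theorem: [T] stands for a slice of the square, [A n] for the piece
    on the layer between [F n.+1] and [F n]. *)
Lemma layered_continuous (T Z : topologicalType) (F G : nat -> set T)
    (A : nat -> T -> Z) (h : T -> Z) :
  F 0%N = setT ->
  (forall n, G n.+2 `<=` F n.+1) -> (forall n, F n.+1 `<=` G n.+1) ->
  (forall n, open (G n)) -> (forall n, closed (F n)) ->
  (forall n, continuous (A n)) ->
  (forall n s, F n.+1 s -> ~ G n.+2 s -> A n s = A n.+1 s) ->
  (forall n s, (F n `\` F n.+1) s -> h s = A n s) ->
  (forall s s', (forall n, F n s) -> (forall n, F n s') -> h s = h s') ->
  (forall s W, (forall n, F n s) -> nbhs (h s) W ->
    exists N, forall n s', (N <= n)%N -> F n s' -> W (A n s')) ->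
  continuous h.
Proof.
move=> F0 GF FG oG cF Ac Aagree hA hE Aunif s.
have GF' n : G n.+1 `<=` F n by case: n => [|n //]; rewrite F0.
have FS n : F n.+1 `<=` F n by move=> x /FG /GF'.
have nbhsS P Q : P `<=` Q -> nbhs s P -> nbhs s Q by exact: filterS.
have nbhsI P Q : nbhs s P -> nbhs s Q -> nbhs s (P `&` Q) by exact: filterI.
have nFnear n : ~ F n s -> nbhs s (~` F n).
  by move=> nF; apply: open_nbhs_nbhs; split => //; exact: closed_openC.
have Gnear n : G n s -> nbhs s (G n).
  by move=> Gs; exact: open_nbhs_nbhs.
have [Es|/existsNP[m /(exists_layer F0)[n [Fn nFn]]]] :=
    pselect (forall n, F n s).
(* Points of [G N.+1] lie in [F N], so each of them either lies in every [F n] or has layer index at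
   least [N]. *)
- move=> W Wh; have [N AW] := Aunif s W Es Wh.
  apply: nbhsS (Gnear N.+1 (FG _ _ (Es N.+1))) => s' /GF' FNs' /=.
  have [Es'|/existsNP[m /(exists_layer F0)[n [Fn nFn]]]] :=
      pselect (forall n, F n s').
    by rewrite (hE s' s) //; exact: nbhs_singleton.
  rewrite (hA n) //; apply: AW => //; rewrite leqNgt; apply/negP => nN.
  exact: nFn (decreasing_subset FS nN FNs').
- have hs : h s = A n s by exact: hA.
  move=> W Wh; change (nbhs s (h @^-1` W)); have Wn : nbhs s (A n @^-1` W).
    by apply: Ac; rewrite -hs.
  (* Inside [G n.+1], a whole neighbourhood of [s] stays in layer [n]. *)
  have [Gn|nGn] := pselect (G n.+1 s).
    have near_s := nbhsI _ _ (nbhsI _ _ Wn (Gnear _ Gn)) (nFnear _ nFn).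
    apply: nbhsS near_s => s' [[Ws' /GF' Fs'] nFs'] /=.
    by rewrite (hA n).
  (* Outside it, neighbours may fall into the preceding layer, whose piece has the same value at [s]
     by [Aagree]. Layer 0 has no predecessor. *)
  case: n => [|n] in Fn nFn hs Wn nGn *.
    have near_s := nbhsI _ _ Wn (nFnear _ nFn).
    apply: nbhsS near_s => s' [Ws' nFs'] /=.
    by rewrite (hA 0%N) // F0.
  have Wn' : nbhs s (A n @^-1` W).
    by apply: Ac; rewrite (Aagree n) // -hs.
  have near_s :=
    nbhsI _ _ (nbhsI _ _ Wn Wn') (nbhsI _ _ (Gnear _ (FG _ _ Fn)) (nFnear _ nFn)).
  apply: nbhsS near_s => s' [[Ws' Ws''] [/GF' Fs' nFs']] /=.
  have [FSs'|nFSs'] := pselect (F n.+1 s'); first by rewrite (hA n.+1).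
  by rewrite (hA n).
Qed.

Lemma cvg_choice_uniform (I : Type) (Z : topologicalType) (z : Z)
    (D : nat -> set I) (B : nat -> I -> Z) (W : set Z) :
  (forall n, D n !=set0) ->
  (forall i_ : nat -> I, (forall n, D n (i_ n)) ->
    (fun n => B n (i_ n)) @ \oo --> z) ->
  nbhs z W ->
  exists N, forall n i, (N <= n)%N -> D n i -> W (B n i).
Proof.
move=> D0 Bz Wz.
(* [i_ n] is a counterexample to [W] in [D n] whenever there is one, so success at [i_ n] certifies
   all of [D n]. *)
have /choice[i_ iP] n : exists i, D n i /\ (W (B n i) -> D n `<=` W \o B n).
  have [DW|/existsNP[i /not_implyP[Di nW]]] := pselect (D n `<=` W \o B n).
    by have [i Di] := D0 n; exists i.
  by exists i.
have [N _ NW] := Bz i_ (fun n => (iP n).1) W Wz.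
by exists N => n i Nn; apply: (iP n).2; exact: NW.
Qed.

Theorem theorem2p1 (R : realType) (X Z : topologicalType)
  (hausdorffZ : hausdorff_space Z)
  (Z1 : set Z) (lambda : Z * Z * R -> Z)
  (equiZ1 : equiconnected_subspace Z1 lambda)
  (g : X -> Z)
  (G F : nat -> set (X * X)) (phi : nat -> X * X -> R) (u : nat -> X -> Z)
  (openG : forall n, functionally_open R (G n))
  (closedF : forall n, functionally_closed R (F n))
  (phi01 : forall n, (0 < n)%N -> forall p, phi n p \in `[0, 1])
  (phi_cont : forall n, (0 < n)%N -> separately_continuous (phi n))
  (uZ1 : forall n, (0 < n)%N -> forall x, Z1 (u n x))
  (u_cont : forall n, (0 < n)%N -> continuous (u n))
  (G0 : G 0%N = setT) (F0 : F 0%N = setT)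
  (GF : forall n, (0 < n)%N ->
    [/\ [set (x, x) | x in [set: X]] `<=` G n.+1,
        G n.+1 `<=` F n & F n `<=` G n])
  (phi_GF : forall n, (0 < n)%N ->
    ~` G n `<=` phi n @^-1` [set 0] /\ F n `<=` phi n @^-1` [set 1])
  (cvg_g : forall (x : X) (t_ : nat -> R) (x_ : nat -> X),
    (forall n, (0 < n)%N -> t_ n \in `[0, 1]) ->
    (forall n, (0 < n)%N -> F n.-1 (x_ n, x)) ->
    (fun n => lambda (u n (x_ n), u n.+1 (x_ n), t_ n)) @ \oo --> g x) :
  exists f : X * X -> Z,
    unique (piecewise_spec lambda g G F phi u) f /\ separately_continuous f.
Proof.
have [_ lam_cont lam_ends _] := equiZ1.
have I0 : (0 : R) \in `[0, 1] by rewrite in_itv /= lexx ler01.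
have GSF n : G n.+2 `<=` F n.+1 by have [] := GF n.+1 isT.
have FG n : F n.+1 `<=` G n.+1 by have [] := GF n.+1 isT.
have FS n : F n.+1 `<=` F n.
  by case: n => [|n]; [rewrite F0 | exact: subset_trans (FG _) (GSF n)].
have Fdiag n x : F n (x, x).
  case: n => [|n]; first by rewrite F0.
  by apply: GSF; have [dG _ _] := GF n.+1 isT; apply: dG; exists x.
have EF p : (\bigcap_(n in [set n | (0 < n)%N]) G n) p <-> forall n, F n p.
  split=> [Ep [|n]|Fp [//|n] _]; [by rewrite F0 | | exact: FG].
  by apply: GSF; exact: Ep.
(* The index is shifted by one: [A n] is the piece on [F n] minus [F n.+1]. *)
pose A n p := lambda (u n.+1 p.1, u n.+2 p.1, phi n.+1 p).
have [f fA fE] : exists2 f : X * X -> Z,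
    forall n p, (F n `\` F n.+1) p -> f p = A n p &
    forall p, (forall n, F n p) -> f p = g p.1.
  suff /choice[f fP] p : exists z, (forall n, (F n `\` F n.+1) p -> z = A n p) /\
      ((forall n, F n p) -> z = g p.1).
    by exists f => [n p|p]; [exact: (fP p).1 | exact: (fP p).2].
  have [Ep|/existsNP[m /(exists_layer F0)[n np]]] :=
      pselect (forall n, F n p).
    by exists (g p.1); split=> // n [_]; case.
  exists (A n p); split=> [k kp|Ep]; last by case: np => _; case.
  by rewrite (layer_unique FS np kp).
have unif y W : nbhs (g y) W -> exists N, forall n x t, (N <= n)%N ->
    F n (x, y) -> t \in `[0, 1] -> W (lambda (u n.+1 x, u n.+2 x, t)).
  (* Points and times are chosen jointly, as pairs. At index 0, [0.-1] is 0, and the diagonal makes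
     every [D n] nonempty. *)
  pose D n := [set i : X * R | F n.-1 (i.1, y) /\ i.2 \in `[0, 1]].
  pose B n (i : X * R) := lambda (u n i.1, u n.+1 i.1, i.2).
  move=> Wy; have [||N NW] := @cvg_choice_uniform _ _ (g y) D B W _ _ Wy.
  - by move=> n; exists (y, 0); split => //=; exact: Fdiag.
  - move=> i_ iD.
    by apply: (cvg_g y (snd \o i_) (fst \o i_)) => n _; have [] := iD n.
  - exists N => n x t Nn Fx t01.
    by apply: (NW n.+1 (x, t)); [exact: leqW |].
(* The sequence with constant point [x] and time 0 tends to [g x], as the diagonal lies in every
   [F n], and to [g y] by [Exy]. *)
have gE x y : (forall n, F n (x, y)) -> g x = g y.
  move=> Exy; apply: (cvg_unique hausdorffZ
    (F := (fun n => lambda (u n x, u n.+1 x, 0)) @ \oo)).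
    by apply: (cvg_g x (fun=> 0) (fun=> x)).
  by apply: (cvg_g y (fun=> 0) (fun=> x)).
(* Covers both variables: [c] is one of the two slices of [X * X]. *)
have slice (c : X -> X * X) : continuous c ->
    (forall n, continuous (phi n.+1 \o c)) ->
    (forall s s', (forall n, F n (c s)) -> (forall n, F n (c s')) ->
      f (c s) = f (c s')) ->
    (forall s W, (forall n, F n (c s)) -> nbhs (f (c s)) W ->
      exists N, forall n s', (N <= n)%N -> F n (c s') -> W (A n (c s'))) ->
    continuous (f \o c).
  move=> c_cont phic fc Ac.
  have uc_cont n : continuous (fun s => u n.+1 (c s).1).
    move=> s; apply: (@continuous_comp _ _ _ (fst \o c)); last exact: u_cont.
    by apply: continuous_comp; [exact: c_cont | exact: cvg_fst].
  apply: (@layered_continuous _ _ (fun n => c @^-1` F n)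
    (fun n => c @^-1` G n) (fun n => A n \o c)) => //.
  - by rewrite F0.
  - by move=> n s; exact: GSF.
  - by move=> n s; exact: FG.
  - move=> n; apply: open_comp => [s _|]; first exact: c_cont.
    exact: functionally_open_open (openG n).
  - move=> n; apply: preimage_closed => [s _|]; first exact: c_cont.
    exact: functionally_closed_closed (closedF n).
  - move=> n; apply: (continuous_comp_within (h := fun s =>
      (u n.+1 (c s).1, u n.+2 (c s).1, phi n.+1 (c s))) lam_cont) => s.
      apply: continuous_pair; last exact: phic.
      by apply: continuous_pair; exact: uc_cont.
    by split; [split; exact: uZ1 | exact: phi01].
  (* Both pieces equal [u n.+2] here: the first path is at its end, the second at its start. *)
  - move=> n s /= Fs nGs; rewrite /A.
    have -> : phi n.+1 (c s) = 1 by exact: (phi_GF n.+1 isT).2.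
    have -> : phi n.+2 (c s) = 0 by exact: (phi_GF n.+2 isT).1.
    have [_ ->] := lam_ends _ _ (uZ1 n.+2 isT (c s).1) (uZ1 n.+1 isT (c s).1).
    by have [-> _] := lam_ends _ _ (uZ1 n.+2 isT (c s).1) (uZ1 n.+3 isT (c s).1).
  - by move=> n s; exact: fA.
exists f; split.
  split=> [|f' [f'A f'E]].
    split=> [[//|n] _ x y|x y /EF]; [exact: fA | exact: fE].
  apply: funext => -[x y].
  have [Exy|/existsNP[m /(exists_layer F0)[n nxy]]] :=
      pselect (forall n, F n (x, y)).
    by rewrite fE // f'E //; apply/EF.
  by rewrite (fA n) // (f'A n.+1).
split=> [x|y].
(* With [x] fixed, only the time varies; [unif] is used at [x], where membership in [F n] concerns
   the diagonal point [(x, x)]. *)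
- apply: (slice (pair x)) => [||s s' Es Es'|s W Es].
  + by apply: continuous_pair => s'; [exact: cvg_cst | exact: cvg_id].
  + by move=> n; exact: (phi_cont n.+1 isT).1.
  + by rewrite !fE.
  + rewrite fE // => /unif[N NW]; exists N => n s' Nn Fs'.
    by apply: NW => //; exact: phi01.
(* With [y] fixed, [unif] is used at [y], and [gE] turns the value [g s] into the limit [g y]. *)
- apply: (slice (pair^~ y)) => [||s s' Es Es'|s W Es].
  + by apply: continuous_pair => s'; [exact: cvg_id | exact: cvg_cst].
  + by move=> n; exact: (phi_cont n.+1 isT).2.
  + by rewrite !fE //= (gE _ _ Es) (gE _ _ Es').
  + rewrite fE //= (gE _ _ Es) => /unif[N NW]; exists N => n s' Nn Fs'.
    by apply: NW => //; exact: phi01.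
Qed.
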